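(* Let $1<p<\infty$, let $\omega$ be a locally finite positive Borel measure on $\mathbb R^{n+1}_+$ and $\sigma$ a locally finite positive Borel measure on $\mathbb R^n$. Suppose that $P^\sigma\mathbf 1\not\equiv+\infty$ and that there is a constant $C$ such that $$P^\omega\big[(P^\sigma\mathbf 1)^p\big](x,t)\le C\,P^\sigma\mathbf 1(x,t)\qquad\text{for all }(x,t)\in\mathbb R^{n+1}_+ .$$ Then there is a constant $C'$ such that $$\|P^\sigma f\|_{L^p(\omega)}\le C'\,\|f\|_{L^p(\sigma)}\qquad\text{for all }f\in L^p(\sigma).$$
   Context: $\mathbb R^{n+1}_+=\mathbb R^n\times(0,\infty)$. $P_t(y)=C_n\,t/(\|y\|^2+t^2)^{(n+1)/2}$, $y\in\mathbb R^n$, $t>0$, is the Poisson kernel of the upper half-space. For $f$ on $\mathbb R^n$, $P^\sigma f(x,t)=\int_{\mathbb R^n}P_t(x-y)f(y)\,d\sigma(y)$; in particular $P^\sigma\mathbf 1(x,t)=\int P_t(x-y)\,d\sigma(y)$. For $g\ge0$ on $\mathbb R^{n+1}_+$, $P^\omega g(x,t)=\int_{\mathbb R^{n+1}_+}P_{t+\tau}(x-y)\,g(y,\tau)\,d\omega(y,\tau)$. *)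

(* Defs.v *)
From HB Require Import structures.
From mathcomp Require Import all_boot all_order all_algebra.
From mathcomp Require Import all_classical all_reals all_analysis.

Set Implicit Arguments.
Unset Strict Implicit.
Unset Printing Implicit Defensive.

Import Order.TTheory GRing.Theory Num.Theory.
Import numFieldNormedType.Exports.

Local Open Scope classical_set_scope.
Local Open Scope ring_scope.

(* The type T equipped with its Borel sigma-algebra. *)
Notation borel T := (g_sigma_algebraType (@open T)).

Definition locally_finite (R : realType) (T : ptopologicalType)
    (mu : {measure set (borel T) -> \bar R}) : Prop :=
  forall x : T, exists2 U : set T, open_nbhs x U & (mu U < +oo)%E.

(* The open upper half-space, as a type carrying the subspace topology, so that
   a Borel measure on it may have infinite mass near the boundary. *)
Definition upper_half_space (R : realType) (n : nat) : Type :=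
  set_type [set z : 'rV[R]_n * R | 0 < z.2].

Section upper_half_space_structures.
Context (R : realType) (n : nat).

Fact upper_half_space_point_subproof :
  ((0, 1) : 'rV[R]_n * R) \in [set z : 'rV[R]_n * R | 0 < z.2].
Proof. by rewrite inE /= ltr01. Qed.

HB.instance Definition _ := Topological.copy (upper_half_space R n)
  (set_type [set z : 'rV[R]_n * R | 0 < z.2]).
HB.instance Definition _ := isPointed.Build (upper_half_space R n)
  (SigSub upper_half_space_point_subproof).

End upper_half_space_structures.

Definition uhs_space (R : realType) (n : nat) (z : upper_half_space R n) :
  'rV[R]_n := (set_val z).1.

Definition uhs_height (R : realType) (n : nat) (z : upper_half_space R n) : R :=
  (set_val z).2.

(* The norm `|y| of 'rV[R]_n in the library is the sup norm. *)
Definition euclidean_norm (R : realType) (n : nat) (y : 'rV[R]_n) : R :=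
  Num.sqrt (\sum_(i < n) y 0 i ^+ 2).

Definition Gamma (R : realType) (s : R) : R :=
  \int[lebesgue_measure]_(x in `]0, +oo[) (x `^ (s - 1) * expR (- x)).

(* Normalized so that the Poisson kernel has total mass 1 at each height. *)
Definition poisson_const (R : realType) (n : nat) : R :=
  Gamma (n.+1%:R / 2) / pi `^ (n.+1%:R / 2).

Definition poisson_kernel (R : realType) (n : nat) (t : R) (y : 'rV[R]_n) : R :=
  poisson_const R n * t /
    (euclidean_norm y ^+ 2 + t ^+ 2) `^ (n.+1%:R / 2).

Definition poisson (R : realType) (n : nat)
    (sigma : {measure set (borel 'rV[R]_n) -> \bar R}) (f : 'rV[R]_n -> R)
    (z : upper_half_space R n) : \bar R :=
  (\int[sigma]_y
     (poisson_kernel (uhs_height z) (uhs_space z - (y : 'rV[R]_n)) * f y)%:E)%E.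

Definition poisson_uhs (R : realType) (n : nat)
    (omega : {measure set (borel (upper_half_space R n)) -> \bar R})
    (g : upper_half_space R n -> \bar R) (z : upper_half_space R n) : \bar R :=
  (\int[omega]_w
     ((poisson_kernel (uhs_height z + uhs_height w)
         (uhs_space z - uhs_space w))%:E * g w))%E.

(* Main.v *)
Require Import Defs.
From HB Require Import structures.
From mathcomp Require Import all_boot all_order all_algebra.
From mathcomp Require Import all_classical all_reals all_analysis measurable_realfun.
From mathcomp Require Import ring lra.

Set Implicit Arguments.
Unset Strict Implicit.
Unset Printing Implicit Defensive.

Import Order.TTheory GRing.Theory Num.Theory.
Import numFieldNormedType.Exports.

Local Open Scope classical_set_scope.
Local Open Scope ring_scope.

(** Write [v] for the Poisson extension of [sigma], and [mu] for the measure
    [v^p omega]. Since [P^sigma f = v * (P^sigma f / v)], the conclusion says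
    that the averaging operator [A f = P^sigma f / v] maps [L^p(sigma)] to
    [L^p(mu)]. As [A] is a contraction from [L^oo(sigma)] to [L^oo(mu)], real
    interpolation ([interpolation]) reduces the theorem to the weak type (1,1)
    bound ([poisson_weak_type])

      [c * mu {P^sigma f > c v} <= K * \int f dsigma   for c > 0 and f >= 0.]

    This bound comes from playing the hypothesis off against the definition of
    the level set [E = {P^sigma f > c v}]. At a point [z = (x, t)] of [E] the
    hypothesis, with [mu] cut down to [E], yields

      [P^omega(1_E v^p)(z) <= C v(z) < (C / c) P^sigma f (z).]

    Both ends compare with sums over the scales [2^j t], [j >= 0], with the same weights
    [t (2^j t)^-(n+1)]. On the right the weights multiply the masses of
    [f sigma] in the balls of centre [x] and radius [2^(j+1) t]
    ([poisson_upper]). On the left, shifting the scales by a fixed number of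
    steps costs only a constant, and the weights multiply the masses of [mu] on
    [E] in the Carleson boxes over the sixteen times larger balls
    ([poisson_uhs_lower]); it is essential here that the kernel of [P^omega]
    is evaluated at the height [t + tau], so that it dominates [t] times a power
    of the distance. A strict inequality between two such sums must hold for
    one of the terms, so some ball [B(x, r)] with [t < r] satisfies

      [c * mu (E /\ W(x, 16 r)) <= K * \int_B(x, r) f dsigma]

    where [W] denotes the Carleson box ([local_selection]). The boxes [W(x, r)]
    cover [E]; a Vitali selection makes the balls disjoint while tripled boxes
    still cover, and the factor 16 leaves room both for this tripling and for
    moving to rational centres and radii, which makes the family countable.
    Summing over the disjoint balls gives the weak type bound.

    Balls are those of the sup norm of [R^n], whose kernel bounds differ from
    the Euclidean ones by constants depending on [n] only. *)

(** * Dyadic decompositions *)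

(** The range above [s * v] is cut into the dyadic layers on which the layer
    cake formula is run. *)
Lemma dyadic_level (R : realType) (s v g : R) :
  0 < v -> 0 < s -> s * v < g ->
  exists k, s * 2 ^+ k * v < g <= s * 2 ^+ k.+1 * v.
Proof.
move=> v0 s0 sg.
have ex : exists n, g <= s * 2 ^+ n * v.
  have sv0 : 0 < s * v by rewrite mulr_gt0.
  exists (Num.bound (g / (s * v))).
  set N := Num.bound _.
  have := ltW (archi_boundP (divr_ge0 (le_trans (ltW sv0) (ltW sg)) (ltW sv0))).
  rewrite -/N ler_pdivrMr// => /le_trans; apply.
  rewrite mulrAC [s * v * _]mulrC ler_pM2r// -natrX ler_nat.
  exact/ltnW/ltn_expl.
case: (ex_minnP ex) => -[|k] gk kmin.
  by move: gk; rewrite expr0 mulr1 leNgt sg.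
exists k; rewrite gk andbT ltNge; apply/negP => /kmin.
by rewrite ltnn.
Qed.

(** A geometric sum is comparable to its last term, and truncation keeps that
    term below [x]; this is what makes the sum over the levels converge in the
    interpolation argument. *)
Lemma truncated_geometric_sum (R : realType) (q c x : R) (n : nat) :
  1 < q -> 0 < c -> 0 <= x ->
  \sum_(0 <= k < n) (if c * q ^+ k < x then c * q ^+ k else 0)
    <= q / (q - 1) * x.
Proof.
move=> q1 c0 x0; have q10 : 0 < q - 1 by rewrite subr_gt0.
have q0 : 0 < q by rewrite (lt_trans _ q1).
have full m : \sum_(0 <= k < m) c * q ^+ k = c * (q ^+ m - 1) / (q - 1).
  elim: m => [|m IH]; first by rewrite big_geq// expr0 subrr mulr0 mul0r.
  rewrite big_nat_recr//= IH exprS; field; exact: lt0r_neq0.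
elim: n => [|n IH]; first by rewrite big_geq// mulr_ge0// divr_ge0 ?ltW.
rewrite big_nat_recr//=; case: ifPn => [cx|_]; last by rewrite addr0.
apply: (@le_trans _ _ (\sum_(0 <= k < n.+1) c * q ^+ k)).
  rewrite big_nat_recr//= lerD2r; apply: ler_sum => k _.
  by case: ifPn => // _; rewrite mulr_ge0 ?exprn_ge0 ?ltW.
rewrite full [leRHS]mulrAC ler_wpM2r ?invr_ge0 ?(ltW q10)//.
apply: (@le_trans _ _ (q * (c * q ^+ n))); last by rewrite ler_wpM2l ?ltW.
by rewrite mulrBr mulr1 exprS mulrCA gerBl ltW.
Qed.

Lemma nneseries_le_partial (R : realType) (u : nat -> \bar R) (M : \bar R) :
  (forall k, 0 <= u k)%E -> (forall n, \sum_(0 <= k < n) u k <= M)%E ->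
  (\sum_(k <oo) u k <= M)%E.
Proof.
move=> u0 uM; apply: lime_le; first exact: is_cvg_nneseries.
exact: nearW.
Qed.

Lemma nneseries_ge_term (R : realType) (u : nat -> \bar R) k :
  (forall k, 0 <= u k)%E -> (u k <= \sum_(j <oo) u j)%E.
Proof.
move=> u0; apply: le_trans (nneseries_lim_ge k.+1 _) => //.
by rewrite big_nat_recr//= leeDr// sume_ge0.
Qed.

(** * Marcinkiewicz interpolation between weak type (1,1) and L^oo *)

Section interpolation.
Context d d' (X : measurableType d) (Y : measurableType d') (R : realType).
Variables (sigma : {measure set X -> \bar R}).
Variables (omega : {measure set Y -> \bar R}).
Variables (T : (X -> R) -> Y -> \bar R) (v : Y -> \bar R) (p C : R).
Local Open Scope ereal_scope.

Let nonneg_mfun (f : X -> R) :=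
  measurable_fun setT f /\ forall x, (0 <= f x)%R.

Hypothesis p_gt1 : (1 < p)%R.
Hypothesis C_ge0 : (0 <= C)%R.
Hypothesis v_ge0 : forall y, 0 <= v y.
Hypothesis v_fin : forall y, v y < +oo.
Hypothesis mv : measurable_fun setT v.
Hypothesis T_ge0 : forall f y, nonneg_mfun f -> 0 <= T f y.
Hypothesis mT : forall f, nonneg_mfun f -> measurable_fun setT (T f).
Hypothesis T_null : forall f y, nonneg_mfun f -> v y = 0 -> T f y = 0.
Hypothesis T_sub : forall f g (c : R) y, nonneg_mfun f -> nonneg_mfun g ->
  (0 <= c)%R -> (forall x, f x <= g x + c)%R -> T f y <= T g y + c%:E * v y.
Hypothesis T_weak : forall f (c : R), nonneg_mfun f -> (0 < c)%R ->
  c%:E * \int[omega]_(y in [set y | c%:E * v y < T f y]) v y `^ p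
    <= C%:E * \int[sigma]_x (f x)%:E.

(** The factor [4 `^ p] pays for comparing the level [s 2^(k+1)], which bounds
    the operator on a layer, with the truncation height [s 2^(k-1)]; the last
    factor is the sum of the geometric series of ratio [2 `^ (p - 1)], which
    is where [1 < p] enters. *)
Definition interpolation_const : R :=
  (C * 4 `^ p * (2 `^ (p - 1) / (2 `^ (p - 1) - 1)))%R.

Lemma interpolation_const_ge0 : (0 <= interpolation_const)%R.
Proof.
have q1 : (1 <= 2 `^ (p - 1) :> R)%R.
  have := @ge0_ler_powR R (p - 1) _ 1%R 2%R.
  by rewrite powR1 !nnegrE subr_ge0 ler1n => ->//; exact: ltW.
by rewrite !mulr_ge0 ?powR_ge0 ?invr_ge0 ?subr_ge0.
Qed.

Let level f (c : R) := [set y | c%:E * v y < T f y].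

Let measurable_level f c : nonneg_mfun f -> measurable (level f c).
Proof.
move=> fP; rewrite -[level f c]setTI.
by apply: measurable_lte => //; [exact: measurable_funeM|exact: mT].
Qed.

Let mvp D : measurable_fun D (fun y => v y `^ p).
Proof.
by apply: measurable_funTS; apply: (measurableT_comp (measurable_poweR p)).
Qed.

(** Only the term of the dyadic layer that contains the point is kept. *)
Let layer_bound f (s : R) y : nonneg_mfun f -> (0 < s)%R -> T f y < +oo ->
  level f s y ->
  T f y `^ p <= \sum_(k <oo) (((s * 2 ^+ k.+1) `^ p)%:E *
    ((fun y => v y `^ p) \_ (level f (s * 2 ^+ k)%R)) y).
Proof.
move=> fP s0 Tfin; rewrite /level/= => sT.
have T0 := T_ge0 y fP; have := @T_null f y fP; have := v_ge0 y; have := v_fin y.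
move: sT T0 Tfin.
case gE : (T f y) => [g| |]//; case wE : (v y) => [w| |]//.
rewrite -EFinM lte_fin !lee_fin => sw g0 _ _ w0 wn.
have {}w0 : (0 < w)%R.
  rewrite lt_neqAle w0 andbT eq_sym; apply/eqP => w00.
  have [g00] : g%:E = 0 by apply: wn; rewrite w00.
  by move: sw; rewrite w00 g00 mulr0 ltxx.
have [k /andP[k1 k2]] := dyadic_level w0 s0 sw.
pose u j := ((s * 2 ^+ j.+1) `^ p)%:E *
    ((fun y => v y `^ p) \_ (level f (s * 2 ^+ j)%R)) y.
apply: (@le_trans _ _ (u k)).
  rewrite /u /patch mem_set; last by rewrite /level/= gE wE -EFinM lte_fin.
  rewrite wE !poweR_EFin -EFinM lee_fin -powRM ?mulr_ge0 ?exprn_ge0 ?(ltW s0) ?(ltW w0)//.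
  apply: ge0_ler_powR => //.
  - by rewrite ltW// (lt_trans _ p_gt1).
  - by rewrite nnegrE !mulr_ge0 ?exprn_ge0 ?(ltW s0) ?(ltW w0).
apply: (@nneseries_ge_term _ u) => j.
by rewrite mule_ge0 ?lee_fin ?powR_ge0// /patch; case: ifPn => // _; rewrite poweR_ge0.
Qed.

Let trunc (f : X -> R) (c : R) x := if (c < f x)%R then f x else 0%R.

Let nonneg_trunc f c : nonneg_mfun f -> nonneg_mfun (trunc f c).
Proof.
case=> mf f0; split; last by move=> x; rewrite /trunc; case: ifPn.
apply: measurable_fun_ifT => //.
exact: measurable_fun_ltr.
Qed.

(** Cutting [f] at height [c] changes [T f] by at most [c * v], so the level set
    at [2 * c] of [T f] lies in the level set at [c] of the operator applied to
    the high part of [f], to which the weak type bound applies. *)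
Let level_bound f (c : R) : nonneg_mfun f -> (0 < c)%R ->
  c%:E * \int[omega]_(y in level f (2 * c)) v y `^ p
   <= C%:E * \int[sigma]_x (trunc f c x)%:E.
Proof.
move=> fP c0; have gP := nonneg_trunc c fP.
apply: le_trans (T_weak gP c0); rewrite lee_wpmul2l ?lee_fin ?(ltW c0)//.
apply: ge0_subset_integral; [exact: measurable_level|exact: measurable_level
  |exact: mvp|by move=> *; exact: poweR_ge0|].
move=> y; rewrite /level/= => cT.
have fg x : (f x <= trunc f c x + c)%R.
  by rewrite /trunc; case: ifPn => [_|]; [rewrite lerDl ltW|rewrite add0r -leNgt].
have := lt_le_trans cT (T_sub y fP gP (ltW c0) fg).
rewrite (_ : (2 * c)%:E = c%:E + c%:E); last by rewrite -EFinD; congr (_%:E); lra.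
rewrite ge0_muleDl ?lee_fin ?(ltW c0)// lteD2rE// fin_numM//.
by rewrite ge0_fin_numE.
Qed.

(** The pointwise form of the sum over levels: after factoring out
    [f x], the weights form a geometric progression truncated at
    [f x `^ (p - 1)]. *)
Let trunc_series f (s : R) x : nonneg_mfun f -> (0 < s)%R ->
  \sum_(k <oo) (((s * 2 ^+ k.+1) `^ p * C / (s * 2 ^+ k / 2))%:E *
     (trunc f (s * 2 ^+ k / 2) x)%:E)
  <= (interpolation_const * f x `^ p)%:E.
Proof.
move=> [_ f0] s0.
have c0 k : (0 < s * 2 ^+ k / 2)%R by rewrite divr_gt0// mulr_gt0// exprn_gt0.
apply: nneseries_le_partial => [k|n].
  rewrite -EFinM lee_fin mulr_ge0// /trunc; last by case: ifPn.
  by rewrite mulr_ge0 ?mulr_ge0 ?powR_ge0// invr_ge0 ltW.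
under eq_bigr do rewrite -EFinM; rewrite sumEFin lee_fin.
have p10 : (0 < p - 1)%R by rewrite subr_gt0.
have p0 : (0 < p)%R by rewrite (lt_trans _ p_gt1).
have q1 : (1 < 2 `^ (p - 1) :> R)%R.
  have := @gt0_ltr_powR R _ p10 1%R 2%R.
  by rewrite powR1 !nnegrE ltr1n => ->.
have e0 : (0 < (s / 2) `^ (p - 1))%R by rewrite powR_gt0// divr_gt0.
have := truncated_geometric_sum n q1 e0 (powR_ge0 (f x) (p - 1)).
move=> /(ler_wpM2l (_ : 0 <= C * 4 `^ p * f x)%R)-/(_ _) H.
have {H} := H _; rewrite mulr_ge0 ?mulr_ge0 ?powR_ge0// => /(_ isT).
rewrite -(mulr_powRB1 (f0 x) p0).
rewrite [leRHS](_ : _ =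
    interpolation_const * (f x * f x `^ (p - 1)))%R; last first.
  by rewrite /interpolation_const; ring.
apply: le_trans; rewrite mulr_sumr; apply: ler_sum => k _.
rewrite /trunc; set c := (s * 2 ^+ k / 2)%R.
have cE : ((s / 2) `^ (p - 1) * 2 `^ (p - 1) ^+ k = c `^ (p - 1))%R.
  rewrite -powR_mulrn ?powR_ge0// powRAC -powRM ?powR_ge0 ?divr_ge0 ?ltW//.
  by rewrite powR_mulrn// /c mulrAC.
rewrite cE; case: ifPn => cf; last first.
  by rewrite mulr0; case: ifPn; rewrite ?mulr0// mulr_ge0 ?mulr_ge0 ?powR_ge0.
rewrite ifT; last first.
  by apply: gt0_ltr_powR => //; rewrite nnegrE// ltW// c0.
rewrite (_ : s * 2 ^+ k.+1 = 4 * c)%R; last by rewrite /c exprS; field.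
rewrite powRM// ?(ltW (c0 _))// -(mulr_powRB1 (ltW (c0 k)))// -/c.
rewrite le_eqVlt; apply/orP; left; apply/eqP; field.
exact: lt0r_neq0 (c0 k).
Qed.

(** The levels start at [s], so the layers are indexed by natural numbers; the
    bound does not depend on [s], which can then tend to 0. *)
Lemma interpolation_above f (s : R) : nonneg_mfun f -> (0 < s)%R ->
  (forall y, T f y < +oo) ->
  \int[omega]_(y in level f s) T f y `^ p
   <= interpolation_const%:E * \int[sigma]_x (f x `^ p)%:E.
Proof.
move=> fP s0 Tfin.
have c0 k : (0 < s * 2 ^+ k / 2)%R by rewrite divr_gt0// mulr_gt0// exprn_gt0.
pose l k y := ((s * 2 ^+ k.+1) `^ p)%:E *
    ((fun y => v y `^ p) \_ (level f (s * 2 ^+ k)%R)) y.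
have l0 k y : 0 <= l k y.
  by rewrite mule_ge0 ?lee_fin ?powR_ge0// /patch; case: ifPn => // _; rewrite poweR_ge0.
have ml k : measurable_fun setT (l k).
  apply: measurable_funeM; apply/(measurable_restrictT _ _).1 => //.
  exact: measurable_level.
apply: (@le_trans _ _ (\int[omega]_y \sum_(k <oo) l k y)).
  rewrite integral_mkcond; apply: ge0_le_integral => //=.
  - by move=> y _; rewrite /patch; case: ifPn => // _; rewrite poweR_ge0.
  - apply/(measurable_restrictT _ _).1; first exact: measurable_level.
    apply: measurable_funTS; apply: (measurableT_comp (measurable_poweR p)).
    exact: mT.
  - by apply: ge0_emeasurable_sum.
  - move=> y _; rewrite /patch; case: ifPn => [|_]; last exact: nneseries_ge0.
    by rewrite inE => ly; exact: layer_bound.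
rewrite integral_nneseries//.
apply: (@le_trans _ _ (\sum_(k <oo) \int[sigma]_x
    (((s * 2 ^+ k.+1) `^ p * C / (s * 2 ^+ k / 2))%:E *
     (trunc f (s * 2 ^+ k / 2) x)%:E))).
  apply: lee_nneseries => [k _ _|k _]; first exact: integral_ge0.
  have [mg g0] := nonneg_trunc (s * 2 ^+ k / 2) fP.
  rewrite /l ge0_integralZl_EFin ?powR_ge0//; last 2 first.
  - by move=> y _; rewrite /patch; case: ifPn => // _; rewrite poweR_ge0.
  - by apply/(measurable_restrictT _ _).1 => //; exact: measurable_level.
  rewrite -integral_mkcond.
  rewrite (_ : level f (s * 2 ^+ k)%R = level f (2 * (s * 2 ^+ k / 2))%R); last first.
    by congr level; field.
  rewrite ge0_integralZl_EFin//; last 3 first.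
  - by move=> x _; rewrite lee_fin.
  - exact/measurable_EFinP.
  - by rewrite !mulr_ge0 ?powR_ge0 ?invr_ge0 ?(ltW (c0 k)).
  rewrite [(_ * C / _)%R]mulrAC [in leRHS]EFinM -muleA.
  set a := ((s * 2 ^+ k.+1) `^ p)%R; set c := (s * 2 ^+ k / 2)%R.
  have -> : a%:E = (a / c)%:E * c%:E.
    by rewrite -EFinM divfK// lt0r_neq0 ?(c0 k).
  rewrite -muleA lee_wpmul2l//; first by rewrite lee_fin divr_ge0 ?powR_ge0 ?(ltW (c0 k)).
  exact: (level_bound fP (c0 k)).
rewrite -integral_nneseries//; last 2 first.
- move=> k; apply: measurable_funeM; apply/measurable_EFinP.
  by have [] := nonneg_trunc (s * 2 ^+ k / 2) fP.
- move=> k x _; have [_ g0] := nonneg_trunc (s * 2 ^+ k / 2) fP.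
  by rewrite mule_ge0// lee_fin// !mulr_ge0 ?powR_ge0 ?invr_ge0 ?(ltW (c0 k)).
have mfp : measurable_fun setT (fun x => (f x `^ p)%:E).
  by apply/measurable_EFinP; apply: (measurableT_comp (measurable_powR p)); case: fP.
have ic0 := interpolation_const_ge0.
rewrite -ge0_integralZl_EFin//; last by move=> x _; rewrite lee_fin powR_ge0.
apply: ge0_le_integral => //.
- move=> x _; apply: nneseries_ge0 => k _ _; have [_ g0] := nonneg_trunc (s * 2 ^+ k / 2) fP.
  by rewrite mule_ge0// lee_fin// !mulr_ge0 ?powR_ge0 ?invr_ge0 ?(ltW (c0 k)).
- apply: ge0_emeasurable_sum => [k x _ _|k _].
    have [_ g0] := nonneg_trunc (s * 2 ^+ k / 2) fP.
    by rewrite mule_ge0// lee_fin// !mulr_ge0 ?powR_ge0 ?invr_ge0 ?(ltW (c0 k)).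
  apply: measurable_funeM; apply/measurable_EFinP.
  by have [] := nonneg_trunc (s * 2 ^+ k / 2) fP.
- exact: measurable_funeM.
- by move=> x _; rewrite -EFinM; exact: trunc_series.
Qed.

(** Marcinkiewicz interpolation for operators normalized by [v]: [T] is
    positive, [T_sub] combines subadditivity with the [L^oo] bound of [T / v],
    and [T_weak] is the weak type (1,1) bound for [T / v] with respect to
    [v `^ p] times [omega]. *)
Lemma interpolation f : nonneg_mfun f -> (forall y, T f y < +oo) ->
  \int[omega]_y T f y `^ p
   <= interpolation_const%:E * \int[sigma]_x (f x `^ p)%:E.
Proof.
move=> fP Tfin; pose F n := level f (n.+1%:R^-1)%R.
have mF n : measurable (F n) by exact: measurable_level.
have mTp D : measurable_fun D (fun y => T f y `^ p).
  by apply: measurable_funTS; apply: (measurableT_comp (measurable_poweR p)); exact: mT.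
have ndF : nondecreasing_seq F.
  move=> m n mn; apply/subsetPset => y; rewrite /F /level/=; apply: le_lt_trans.
  by rewrite lee_wpmul2r// lee_fin lef_pV2 ?posrE// ler_nat.
have TF0 y : (~` \bigcup_n F n) y -> T f y `^ p = 0.
  move=> nF; have T0 := T_ge0 y fP.
  suff -> : T f y = 0 by rewrite poweR0r// gt_eqF// (lt_trans _ p_gt1).
  apply/eqP; rewrite eq_le T0 andbT; apply/lee_addgt0Pr => e e0.
  have := v_ge0 y; have := v_fin y; case wE : (v y) => [w| |]// _; rewrite lee_fin => w0.
  pose n := Num.bound (w / e).
  have Tn : T f y <= (n.+1%:R^-1 * w)%:E.
    have nFn : ~ F n y by move=> Fny; apply: nF; exists n.
    by rewrite EFinM -wE leNgt; apply/negP.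
  rewrite add0e (le_trans Tn)// lee_fin ler_pdivrMl// -ler_pdivrMr//.
  rewrite (le_trans (ltW (archi_boundP _))) ?divr_ge0 ?(ltW e0)//.
  by rewrite ler_nat.
have -> : \int[omega]_y T f y `^ p = \int[omega]_(y in \bigcup_n F n) T f y `^ p.
  rewrite [RHS]integral_mkcond; apply: eq_integral => y _; rewrite /patch.
  case: ifPn => //; rewrite notin_setE; exact: TF0.
have := @ge0_nondecreasing_set_cvg_integral _ _ _ F (fun y => T f y `^ p) omega ndF mF.
move=> /(_ _ _)/cvg_lim <-//.
- apply: lime_le.
  + apply: ereal_nondecreasing_is_cvgn.
    by apply: ge0_nondecreasing_set_nondecreasing_integral => // n y _; exact: poweR_ge0.
  + by apply: nearW => n; exact: interpolation_above.
- by move=> n y _; exact: poweR_ge0.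
Qed.

End interpolation.

(** * Size estimates for the Poisson kernel *)

Section kernel_bounds.
Context (R : realType) (n : nat).
Implicit Types (x y : 'rV[R]_n) (t r : R).

Lemma poisson_const_ge0 : 0 <= poisson_const R n.
Proof.
rewrite divr_ge0 ?powR_ge0// Rintegral_ge0// => x _.
by rewrite mulr_ge0 ?powR_ge0 ?expR_ge0.
Qed.

Lemma powR_half_sqr r : 0 <= r -> (r ^+ 2) `^ (n.+1%:R / 2) = r ^+ n.+1.
Proof.
move=> r0; rewrite -powR_mulrn// -powRrM mulrC divfK ?pnatr_eq0//.
by rewrite powR_mulrn.
Qed.

Lemma sqr_euclidean_norm y : euclidean_norm y ^+ 2 = \sum_(i < n) y 0 i ^+ 2.
Proof. by rewrite sqr_sqrtr// sumr_ge0// => i _; exact: sqr_ge0. Qed.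

Lemma coord_le_norm y i : `|y 0 i| <= `|y|.
Proof.
rewrite [leRHS]/Num.norm /= mx_normrE.
by apply/bigmax_geP; right => /=; exists (0, i).
Qed.

Lemma norm_le_euclidean y r : 0 <= r -> r <= `|y| -> r ^+ 2 <= euclidean_norm y ^+ 2.
Proof.
move=> r0 ry; rewrite ler_pXn2r ?nnegrE ?sqrtr_ge0//.
apply: le_trans ry _; rewrite [leLHS]/Num.norm /= mx_normrE.
apply: bigmax_le => [|[i j] _ /=]; first exact: sqrtr_ge0.
rewrite ord1 -[leLHS]sqrtr_sqr ler_sqrt; last first.
  by apply: sumr_ge0 => k _; exact: sqr_ge0.
rewrite (bigD1 j)//= lerDl sumr_ge0// => k _; exact: sqr_ge0.
Qed.

Lemma euclidean_le_norm y r : `|y| <= r ->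
  euclidean_norm y ^+ 2 <= n%:R * r ^+ 2.
Proof.
move=> yr; rewrite sqr_euclidean_norm.
apply: (@le_trans _ _ (\sum_(i < n) r ^+ 2)); last first.
  by rewrite sumr_const card_ord mulr_natl.
apply: ler_sum => i _; rewrite -real_normK ?num_real//.
by rewrite lerXn2r ?nnegrE// ?(le_trans (coord_le_norm y i))// (le_trans _ yr).
Qed.

Lemma poisson_kernel_ge0 t y : 0 <= t -> 0 <= poisson_kernel t y.
Proof. by move=> t0; rewrite divr_ge0 ?powR_ge0// mulr_ge0// poisson_const_ge0. Qed.

Lemma poisson_kernel_upper t y r : 0 < t -> 0 < r -> (r <= `|y|) || (r <= t) ->
  poisson_kernel t y <= poisson_const R n * t / r ^+ n.+1.
Proof.
move=> t0 r0 ryt; have c0 := poisson_const_ge0.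
rewrite ler_wpM2l ?(mulr_ge0 c0 (ltW t0))//.
rewrite -powR_half_sqr ?(ltW r0)// lef_pV2 ?posrE ?powR_gt0 ?exprn_gt0//; last first.
  by rewrite ltr_wpDl ?exprn_gt0 ?sqr_ge0.
apply: ge0_ler_powR; rewrite ?nnegrE ?addr_ge0 ?sqr_ge0 ?divr_ge0//.
case/orP: ryt => [ry|rt].
  by rewrite (le_trans (norm_le_euclidean _ ry)) ?lerDl ?sqr_ge0// ltW.
rewrite (@le_trans _ _ (t ^+ 2)) ?lerDr ?sqr_ge0//.
by rewrite lerXn2r ?nnegrE// ltW.
Qed.

(** The height of the evaluation point is [t], but the bound retains a factor
    [s <= t]: with [s] the height of a point [z] and [t] the sum of the heights
    of [z] and [w], it has the same prefactor as the upper bound for the kernel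
    at [z]. *)
Lemma poisson_kernel_lower s t y r : 0 < s -> s <= t -> `|y| <= r -> t <= 2 * r ->
  poisson_const R n * s / ((n + 4)%:R `^ (n.+1%:R / 2) * r ^+ n.+1)
    <= poisson_kernel t y.
Proof.
move=> s0 st yr tr; have c0 := poisson_const_ge0.
have t0 : 0 < t by rewrite (lt_le_trans s0).
have r0 : 0 < r by lra.
rewrite ler_pM ?(mulr_ge0 c0 (ltW s0)) ?invr_ge0 ?mulr_ge0 ?powR_ge0 ?exprn_ge0 ?(ltW r0)//.
  by rewrite ler_wpM2l.
rewrite -powR_half_sqr ?(ltW r0)// -powRM ?exprn_ge0 ?(ltW r0)//.
rewrite lef_pV2 ?posrE ?powR_gt0//; first last.
- by rewrite ltr_wpDl ?exprn_gt0 ?sqr_ge0.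
- by rewrite mulr_gt0 ?exprn_gt0// ltr0n addn_gt0 orbT.
apply: ge0_ler_powR; rewrite ?nnegrE ?addr_ge0 ?sqr_ge0 ?divr_ge0//.
  by rewrite mulr_ge0// sqr_ge0.
rewrite natrD mulrDl lerD ?euclidean_le_norm//.
have -> : 4 * r ^+ 2 = (2 * r) ^+ 2 by ring.
by rewrite lerXn2r ?nnegrE ?mulr_ge0// ltW.
Qed.

(** Harnack inequality: the squared distances from [(x', t')] and [(x, t)] to a
    boundary point [y] have a ratio bounded independently of [y], because
    [(a + b)^2 <= 2 a^2 + 2 b^2] and the distance from [(x, t)] is at least
    [t]. *)
Lemma poisson_kernel_harnack x x' t t' : 0 < t -> 0 < t' ->
  exists2 M : R, 0 <= M & forall y,
    poisson_kernel t (x - y) <= M * poisson_kernel t' (x' - y).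
Proof.
move=> t0 t'0; have c0 := poisson_const_ge0.
pose A := 2 + (2 * euclidean_norm (x' - x) ^+ 2 + t' ^+ 2) / t ^+ 2.
have h : 0 <= 2 * euclidean_norm (x' - x) ^+ 2 + t' ^+ 2.
  by have := sqr_ge0 t'; have := sqr_ge0 (euclidean_norm (x' - x)); lra.
have A0 : 0 < A by rewrite /A ltr_wpDr// divr_ge0// sqr_ge0.
exists (t / t' * A `^ (n.+1%:R / 2)); first by rewrite mulr_ge0 ?powR_ge0// divr_ge0 ?ltW.
move=> y; rewrite /poisson_kernel.
set S := euclidean_norm (x - y) ^+ 2 + t ^+ 2.
set S' := euclidean_norm (x' - y) ^+ 2 + t' ^+ 2.
have S0 : 0 < S by rewrite ltr_wpDl ?exprn_gt0 ?sqr_ge0.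
have S'0 : 0 < S' by rewrite ltr_wpDl ?exprn_gt0 ?sqr_ge0.
have SS : S' <= A * S.
  have E : euclidean_norm (x' - y) ^+ 2 <=
      2 * euclidean_norm (x - y) ^+ 2 + 2 * euclidean_norm (x' - x) ^+ 2.
    rewrite !sqr_euclidean_norm !mulr_sumr -big_split/=; apply: ler_sum => i _.
    rewrite !mxE; have := sqr_ge0 (x 0 i - y 0 i - (x' 0 i - x 0 i)); nra.
  rewrite /A mulrDl -/S.
  have : 2 * euclidean_norm (x' - x) ^+ 2 + t' ^+ 2 <=
     (2 * euclidean_norm (x' - x) ^+ 2 + t' ^+ 2) / t ^+ 2 * S.
    rewrite -mulrA ler_peMr// mulrC ler_pdivlMr ?exprn_gt0// mul1r.
    by rewrite lerDr sqr_ge0.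
  have := sqr_ge0 t.
  rewrite /S' /S; nra.
have -> : t / t' * A `^ (n.+1%:R / 2) * (poisson_const R n * t' / S' `^ (n.+1%:R / 2))
   = poisson_const R n * t * (A `^ (n.+1%:R / 2) / S' `^ (n.+1%:R / 2)).
  by field; rewrite ?lt0r_neq0 ?powR_gt0.
rewrite ler_wpM2l ?(mulr_ge0 c0 (ltW t0))//.
rewrite ler_pdivlMr ?powR_gt0// mulrC ler_pdivrMr ?powR_gt0//.
rewrite -powRM ?(ltW A0) ?(ltW S0)//.
by apply: ge0_ler_powR; rewrite ?nnegrE ?divr_ge0 ?mulr_ge0 ?(ltW A0) ?(ltW S0) ?(ltW S'0).
Qed.

End kernel_bounds.

(** * Borel measurability *)

Section borel_measurability.
Context (R : realType).

Lemma open_borel (T : ptopologicalType) (A : set T) :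
  open A -> measurable (A : set (borel T)).
Proof. exact: sub_sigma_algebra. Qed.

Lemma continuous_borel (T : ptopologicalType) (f : T -> R) : continuous f ->
  measurable_fun [set: borel T] f.
Proof.
move=> /continuousP cf; apply: (measurability _ (RGenOpens.measurableE R)).
move=> _ [_ [a [b ->] <-]]; rewrite setTI; apply: open_borel.
exact/cf/interval_open.
Qed.

Context (n : nat).
Local Notation Rn := (borel 'rV[R]_n).
Local Notation uhs := (borel (upper_half_space R n)).

Lemma measurable_coord i : measurable_fun [set: Rn] (fun y => (y : 'rV_n) 0 i).
Proof. by apply: (@continuous_borel 'rV[R]_n); exact: coord_continuous. Qed.

Lemma continuous_uhs_space : continuous (@uhs_space R n).
Proof.
move=> z; apply: (@continuous_comp _ _ _ set_val fst); last exact: cvg_fst.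
exact: initial_continuous.
Qed.

Lemma continuous_uhs_height : continuous (@uhs_height R n).
Proof.
move=> z; apply: (@continuous_comp _ _ _ set_val snd); last exact: cvg_snd.
exact: initial_continuous.
Qed.

Lemma measurable_uhs_height : measurable_fun [set: uhs] (@uhs_height R n).
Proof. by apply: continuous_borel; exact: continuous_uhs_height. Qed.

Lemma measurable_uhs_coord i :
  measurable_fun [set: uhs] (fun z => uhs_space z 0 i).
Proof.
apply: continuous_borel => z.
apply: (@continuous_comp _ _ _ _ (fun y : 'rV[R]_n => y 0 i)).
  exact: continuous_uhs_space.
exact: coord_continuous.
Qed.

(** The kernel is a measurable function of finitely many real coordinates, so
    joint measurability reduces to measurability of each coordinate and never
    involves the topology of a product. *)
Lemma measurable_poisson_kernel d (T : measurableType d)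
    (h : T -> R) (y : T -> 'rV[R]_n) :
  measurable_fun setT h -> (forall i, measurable_fun setT (fun x => y x 0 i)) ->
  measurable_fun setT (fun x => poisson_kernel (h x) (y x)).
Proof.
move=> mh my; rewrite /poisson_kernel.
apply: measurable_funM; first exact: measurable_funM.
under eq_fun do rewrite sqr_euclidean_norm -powRN.
apply: (measurableT_comp (measurable_powR _)).
apply: measurable_funD; last exact: measurable_funX.
by apply: measurable_sum => i; exact: measurable_funX.
Qed.

End borel_measurability.

(** The measurability half of the Tonelli theorem, for a measure which is only
    known to be sigma-finite through a proof. *)
Lemma measurable_integral_section d1 d2 (T1 : measurableType d1)
    (T2 : measurableType d2) (R : realType)
    (mu : {measure set T2 -> \bar R}) (F : T1 -> T2 -> \bar R) :
  sigma_finite [set: T2] mu ->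
  measurable_fun setT (fun x : T1 * T2 => F x.1 x.2) ->
  (forall x y, 0 <= F x y)%E ->
  measurable_fun setT (fun x => \int[mu]_y F x y)%E.
Proof.
move=> sf mF F0.
pose sfm := isSFinite.Build _ _ _ _ (sfinite_measure_sigma_finite sf).
pose sgm := isSigmaFinite.Build _ _ _ _ sf.
pose mu' := HB.pack_for {sigma_finite_measure set T2 -> \bar R}
  (Measure.sort mu) sfm sgm.
have /= := @measurable_fun_fubini_tonelli_F _ _ _ _ _ mu' _ mF.
by apply => -[x y]; exact: F0.
Qed.

(** * The operator P^sigma *)

Section poisson_operator.
Context (R : realType) (n : nat).
Variable sigma : {measure set (borel 'rV[R]_n) -> \bar R}.
Local Notation uhs := (upper_half_space R n).
Local Notation Rn := (borel 'rV[R]_n).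
Implicit Types (z : uhs) (f g : Rn -> R).

Lemma uhs_height_gt0 z : 0 < uhs_height z.
Proof. exact: (set_valP z). Qed.
Hint Resolve uhs_height_gt0 : core.

Definition pker z (y : Rn) : R := poisson_kernel (uhs_height z) (uhs_space z - y).

Lemma pker_ge0 z y : 0 <= pker z y.
Proof. by rewrite poisson_kernel_ge0// ltW. Qed.
Hint Resolve pker_ge0 : core.

Lemma measurable_pker z : measurable_fun setT (pker z).
Proof.
apply: measurable_poisson_kernel; first exact: measurable_cst.
move=> i; under eq_fun do rewrite !mxE.
by apply: measurable_funB => //; exact: measurable_coord.
Qed.

Lemma measurable_pker2 :
  measurable_fun setT (fun w : borel uhs * Rn => pker w.1 w.2).
Proof.
apply: measurable_poisson_kernel => [|i].
  exact: (measurableT_comp (@measurable_uhs_height R n)).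
under eq_fun do rewrite !mxE.
apply: measurable_funB.
  exact: (measurableT_comp (@measurable_uhs_coord R n i)).
exact: (measurableT_comp (@measurable_coord R n i)).
Qed.

Lemma measurable_pker_mul z f : measurable_fun setT f ->
  measurable_fun setT (fun y => (pker z y * f y)%:E).
Proof.
move=> mf; apply/measurable_EFinP; apply: measurable_funM => //.
exact: measurable_pker.
Qed.

Definition uhs_ker z (w : borel uhs) : R :=
  poisson_kernel (uhs_height z + uhs_height w) (uhs_space z - uhs_space w).

Lemma uhs_ker_ge0 z w : 0 <= uhs_ker z w.
Proof. by rewrite poisson_kernel_ge0// addr_ge0// ltW. Qed.

Lemma measurable_uhs_ker z : measurable_fun [set: borel uhs] (uhs_ker z).
Proof.
apply: measurable_poisson_kernel => [|i].
  by apply: measurable_funD => //; exact: measurable_uhs_height.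
under eq_fun do rewrite !mxE.
by apply: measurable_funB => //; exact: measurable_uhs_coord.
Qed.

Lemma poisson_nonneg f z : (forall y, 0 <= f y) -> (0 <= poisson sigma f z)%E.
Proof.
move=> f0; apply: integral_ge0 => y _; rewrite lee_fin mulr_ge0//.
exact: pker_ge0.
Qed.

(** By the Harnack inequality, finiteness propagates from one point of the
    half-space to all of it. *)
Lemma poisson_lty f z z' : measurable_fun setT f -> (forall y, 0 <= f y) ->
  (poisson sigma f z' < +oo -> poisson sigma f z < +oo)%E.
Proof.
move=> mf f0 fz'.
have [M M0 kM] := poisson_kernel_harnack (uhs_space z) (uhs_space z')
  (uhs_height_gt0 z) (uhs_height_gt0 z').
apply: (@le_lt_trans _ _ (M%:E * poisson sigma f z')%E); last first.
  by rewrite lte_mul_pinfty ?lee_fin// fin_numE.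
rewrite -ge0_integralZl_EFin//; first last.
- exact: measurable_pker_mul.
- by move=> y _; rewrite lee_fin mulr_ge0//; exact: pker_ge0.
apply: ge0_le_integral => //.
- by move=> y _; rewrite lee_fin mulr_ge0//; exact: pker_ge0.
- exact: measurable_pker_mul.
- by apply: measurable_funeM; exact: measurable_pker_mul.
- by move=> y _; rewrite -EFinM lee_fin mulrA ler_wpM2r.
Qed.

Hypothesis const_gt0 : 0 < poisson_const R n.
Hypothesis v_lty : forall z, (poisson sigma (cst 1%R) z < +oo)%E.

(** The kernel at a fixed point is bounded below on every ball, so finiteness of
    the Poisson extension forces balls to have finite mass. *)
Lemma poisson_sigma_finite : sigma_finite [set: Rn] sigma.
Proof.
exists (fun k => ball (0 : 'rV[R]_n) k%:R : set Rn).
  apply/seteqP; split => // y _; exists (Num.bound `|y|) => //.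
  rewrite -ball_normE /= sub0r normrN.
  by rewrite archi_boundP.
move=> k; set B : set Rn := ball _ _; have mB : measurable B.
  by apply: open_borel; exact: ball_open.
split => //; pose z0 : uhs := point.
pose c := poisson_const R n * 1 / ((n + 4)%:R `^ (n.+1%:R / 2) * k.+1%:R ^+ n.+1).
have c0 : 0 < c.
  have c1 := mulr_gt0 const_gt0 ltr01.
  rewrite (divr_gt0 c1)// mulr_gt0 ?exprn_gt0 ?powR_gt0 ?ltr0n ?addn_gt0 ?orbT.
have : (c%:E * sigma B < +oo)%E.
  apply: le_lt_trans (v_lty z0).
  rewrite -integral_cst// integral_mkcond; apply: ge0_le_integral => //.
  - by move=> y _; rewrite /patch; case: ifPn => // _; rewrite lee_fin ltW.
  - exact/(measurable_restrictT _ _).1.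
  - exact: measurable_pker_mul.
  - move=> y _; rewrite /patch; case: ifPn; last first.
      by rewrite lee_fin mulr_ge0//; exact: pker_ge0.
    rewrite inE /B -ball_normE/= sub0r normrN => yk; rewrite mulr1 lee_fin.
    rewrite /c; apply: poisson_kernel_lower => //.
    + by rewrite ?sub0r normrN (le_trans (ltW yk))// ler_nat.
    + by rewrite -natrM (ler_nat R 1) muln_gt0.
rewrite !ltey; apply: contra => /eqP ->.
by rewrite gt0_muley// lte_fin.
Qed.

Lemma measurable_poisson f : measurable_fun setT f -> (forall y, 0 <= f y) ->
  measurable_fun [set: borel uhs] (poisson sigma f).
Proof.
move=> mf f0; apply: (@measurable_integral_section _ _ (borel uhs) Rn _ sigma
  (fun z y => (pker z y * f y)%:E)); first exact: poisson_sigma_finite.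
- apply/measurable_EFinP; apply: measurable_funM; first exact: measurable_pker2.
  exact: (measurableT_comp mf).
- by move=> z y; rewrite lee_fin mulr_ge0//; exact: pker_ge0.
Qed.

Lemma measurable_poisson_signed f : measurable_fun setT f ->
  measurable_fun [set: borel uhs] (poisson sigma f).
Proof.
move=> mf; pose fp y := Num.max (f y) 0; pose fn y := Num.max (- f y) 0.
have fp0 y : 0 <= fp y by rewrite le_max lexx orbT.
have fn0 y : 0 <= fn y by rewrite le_max lexx orbT.
have mfp : measurable_fun setT fp by exact: measurable_maxr.
have mfn : measurable_fun setT fn.
  by apply: measurable_maxr => //; exact: measurable_funN.
rewrite (_ : poisson sigma f = poisson sigma fp \- poisson sigma fn)%E.
  by apply: emeasurable_funB; exact: measurable_poisson.
apply/funext => z; rewrite /poisson integralE; congr (_ - _)%E.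
  apply: eq_integral => y _; rewrite funeposE -EFin_max; congr EFin.
  by rewrite /fp maxr_pMr ?mulr0//; exact: pker_ge0.
apply: eq_integral => y _; rewrite funenegE -EFinN -EFin_max; congr EFin.
by rewrite /fn maxr_pMr ?mulr0 ?mulrN//; exact: pker_ge0.
Qed.

Lemma poisson_null f z : measurable_fun setT f -> (forall y, 0 <= f y) ->
  poisson sigma (cst 1%R) z = 0%E -> poisson sigma f z = 0%E.
Proof.
move=> mf f0 v0; rewrite -[RHS](integral0 sigma setT).
apply: ge0_ae_eq_integral => //.
- exact: measurable_pker_mul.
- by move=> y _; rewrite lee_fin mulr_ge0//; exact: pker_ge0.
have := ae_eq_integral_abs sigma measurableT (@measurable_pker_mul z (cst 1) _).
move=> /(_ (@measurable_cst _ _ Rn R setT 1%R))[+ _].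
have -> : (\int[sigma]_y `|(pker z y * cst 1 y)%:E|)%E = poisson sigma (cst 1%R) z.
  apply: eq_integral => y _; rewrite gee0_abs// lee_fin mulr_ge0//.
move=> /(_ v0); apply: filterS => y /= /(_ I) [].
by rewrite mulr1 /pker => -> _; rewrite mul0r.
Qed.

Lemma poisson_sub f g c z :
  measurable_fun setT f -> (forall y, 0 <= f y) ->
  measurable_fun setT g -> (forall y, 0 <= g y) -> 0 <= c ->
  (forall y, f y <= g y + c) ->
  (poisson sigma f z <= poisson sigma g z + c%:E * poisson sigma (cst 1%R) z)%E.
Proof.
move=> mf f0 mg g0 c0 fg.
rewrite -ge0_integralZl_EFin//; first last.
- exact: measurable_pker_mul.
- by move=> y _; rewrite lee_fin mulr_ge0//; exact: pker_ge0.
rewrite -ge0_integralD//; first last.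
- by apply: measurable_funeM; exact: measurable_pker_mul.
- by move=> y _; rewrite mule_ge0// lee_fin mulr_ge0//; exact: pker_ge0.
- exact: measurable_pker_mul.
- by move=> y _; rewrite lee_fin mulr_ge0//; exact: pker_ge0.
apply: ge0_le_integral => //.
- by move=> y _; rewrite lee_fin mulr_ge0//; exact: pker_ge0.
- exact: measurable_pker_mul.
- apply: emeasurable_funD; first exact: measurable_pker_mul.
  by apply: measurable_funeM; exact: measurable_pker_mul.
- move=> y _; rewrite -EFinM -EFinD lee_fin /= mulr1 [c * _]mulrC -mulrDr.
  by rewrite ler_wpM2l//; exact: pker_ge0.
Qed.

(** Since [f <= f^p + 1] and the kernel at a fixed point is bounded, no Hoelder
    inequality is required. *)
Lemma poisson_Lp_lty p f z : 1 <= p ->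
  measurable_fun setT f -> (forall y, 0 <= f y) ->
  (\int[sigma]_y (f y `^ p)%:E < +oo)%E -> (poisson sigma f z < +oo)%E.
Proof.
move=> p1 mf f0 fp.
have mfp : measurable_fun setT (fun y => f y `^ p).
  exact: (measurableT_comp (measurable_powR p)).
have ffp y : f y <= f y `^ p + 1.
  have [f1|f1] := leP (f y) 1; first by rewrite (le_trans f1)// lerDr powR_ge0.
  rewrite (@le_trans _ _ (f y `^ p)) ?lerDl//.
  by rewrite le1r_powR// ltW.
have := poisson_sub z mf f0 mfp (fun y => powR_ge0 _ _) ler01 ffp.
move=> /le_lt_trans; apply; rewrite mul1e lte_add_pinfty//.
set M := poisson_const R n * uhs_height z / uhs_height z ^+ n.+1.
have M0 : 0 <= M.
  have h0 := uhs_height_gt0 z.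
  by rewrite (divr_ge0 (mulr_ge0 (ltW const_gt0) (ltW h0)))// exprn_ge0// ltW.
apply: (@le_lt_trans _ _ (M%:E * \int[sigma]_y (f y `^ p)%:E)%E); last first.
  rewrite lte_mul_pinfty// ?lee_fin// fin_numE.
rewrite -ge0_integralZl_EFin//; first last.
- exact/measurable_EFinP.
- by move=> y _; rewrite lee_fin powR_ge0.
apply: ge0_le_integral => //.
- by move=> y _; rewrite lee_fin mulr_ge0 ?powR_ge0//; exact: pker_ge0.
- exact: measurable_pker_mul.
- by apply: measurable_funeM; exact/measurable_EFinP.
- move=> y _; rewrite -EFinM lee_fin ler_wpM2r ?powR_ge0//.
  by apply: poisson_kernel_upper => //; rewrite lexx orbT.
Qed.

End poisson_operator.

(** * Covering and summation tools *)

(** The selection step of the Vitali covering lemma, which only involves the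
    radii and the relation of meeting each other: scanning the indices by
    decreasing radius, an index is kept if it meets none of those already
    kept. *)
Lemma vitali_selection (R : realDomainType) (I : eqType) (rad : I -> R)
    (meet : rel I) (s : seq I) : symmetric meet ->
  exists D : seq I, [/\ uniq D, {subset D <= s},
    {in D &, forall i j, i != j -> ~~ meet i j} &
    {in s, forall i, exists2 j, j \in D & (i == j) || meet i j && (rad i <= rad j)}].
Proof.
move=> meetC; pose le i j := rad i <= rad j.
have le_tr : transitive le by move=> ? ? ?; exact: le_trans.
wlog : s / sorted le s.
  have : sorted le (sort le s) by apply: sort_sorted => ? ?; exact: le_total.
  move=> /[swap] /[apply] -[D [uD Ds disj sel]]; exists D; split => //.
  - by move=> i /Ds; rewrite mem_sort.
  - by move=> i; rewrite -(mem_sort le) => /sel.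
elim: s => [_|i s IH]; first by exists [::].
move=> /= /[dup] /path_sorted/IH[D [uD Ds disj sel]].
rewrite (path_sortedE le_tr) => /andP[/allP is_ _].
have [/hasP[j jD ij]|/hasPn nD] := boolP (has (meet i) D).
  exists D; split => //; first by move=> k /Ds ks; rewrite inE ks orbT.
  move=> k; rewrite inE => /predU1P[->|/sel//]; exists j => //.
  by have /= := is_ _ (Ds _ jD); rewrite ij /le => ->; rewrite orbT.
have [iD|iD] := boolP (i \in D).
  exists D; split => //; first by move=> k /Ds ks; rewrite inE ks orbT.
  by move=> k; rewrite inE => /predU1P[->|/sel//]; exists i => //; rewrite eqxx.
exists (i :: D); split => //=; first by rewrite iD.
- by move=> k; rewrite !inE => /predU1P[->|/Ds ->]; rewrite ?eqxx ?orbT.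
- move=> j k; rewrite !inE => /predU1P[->|jD] /predU1P[->|kD]; rewrite ?eqxx//.
  + by move=> _; exact: nD.
  + by move=> _; rewrite meetC; exact: nD.
  + exact: disj.
- move=> k; rewrite inE => /predU1P[->|/sel[j jD kj]].
    by exists i; rewrite ?mem_head ?eqxx.
  by exists j => //; rewrite inE jD orbT.
Qed.

Section integral_union.
Context d (T : measurableType d) (R : realType) (mu : {measure set T -> \bar R}).
Variables (h : T -> \bar R).
Hypotheses (h0 : forall x, (0 <= h x)%E) (mh : measurable_fun setT h).
Local Open Scope ereal_scope.

Lemma integral_setU_le A B : measurable A -> measurable B ->
  \int[mu]_(x in A `|` B) h x <= \int[mu]_(x in A) h x + \int[mu]_(x in B) h x.
Proof.
move=> mA mB.
have -> : A `|` B = A `|` (B `\` A).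
  apply/seteqP; split => [x [Ax|Bx]|x [Ax|[Bx _]]]; [by left| |by left|by right].
  by have [Ax|nAx] := pselect (A x); [left|right].
rewrite ge0_integral_setU//; first last.
- by apply/disj_setPRL => x [].
- exact: measurable_funTS.
- exact: measurableD.
rewrite leeD2l// ge0_subset_integral//; [exact: measurableD|exact: measurable_funTS].
Qed.

Lemma integral_bigsetU_le (I : Type) (s : seq I) (A : I -> set T) :
  (forall i, measurable (A i)) ->
  \int[mu]_(x in \big[setU/set0]_(i <- s) A i) h x <=
  \sum_(i <- s) \int[mu]_(x in A i) h x.
Proof.
move=> mA; elim: s => [|i s IH]; first by rewrite !big_nil integral_set0.
rewrite !big_cons; apply: le_trans (integral_setU_le _ _) _ => //.
  by apply: bigsetU_measurable => *; exact: mA.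
exact: leeD2l.
Qed.

End integral_union.

(** The nonzero terms form a tail of a sequence that at least halves at each
    step, so the sum is at most twice its first nonzero term. *)
Lemma dyadic_tail_sum (R : realType) (m J : nat) (d t b : R) :
  0 < t -> 0 <= b ->
  (forall j, d < 2 ^+ j * t -> (2 ^+ j * t) ^- m.+1 <= b) ->
  \sum_(0 <= j < J) (if d < 2 ^+ j * t then (2 ^+ j * t) ^- m.+1 else 0) <= 2 * b.
Proof.
move=> t0 b0 tb; pose a j := (2 ^+ j * t) ^- m.+1.
have a0 j : 0 < a j by rewrite invr_gt0 exprn_gt0// mulr_gt0// exprn_gt0.
have aS j : 2 * a j.+1 <= a j.
  rewrite /a (_ : 2 ^+ j.+1 * t = 2 * (2 ^+ j * t)); last by rewrite exprS mulrA.
  rewrite [in leLHS]exprMn [X in 2 * X]invfM mulrA ler_piMl//.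
    by rewrite invr_ge0 exprn_ge0// mulr_ge0 ?exprn_ge0// ltW.
  rewrite ler_pdivrMr ?exprn_gt0// mul1r exprS ler_peMr//.
  by rewrite exprn_ege1// ler1n.
(* Subtracting [2 * a J] leaves room for the terms still to come. *)
suff : \sum_(0 <= j < J) (if d < 2 ^+ j * t then a j else 0) <=
    (if d < 2 ^+ J * t then 2 * b - 2 * a J else 0).
  move=> /le_trans; apply; case: ifPn => _; last by rewrite mulr_ge0.
  by rewrite gerBl mulr_ge0// ltW.
elim: J => [|J IH].
  rewrite big_geq//; case: ifPn => // dt; rewrite subr_ge0 ler_wpM2l//.
  exact: tb.
rewrite big_nat_recr//=.
have J2 : 2 ^+ J * t <= 2 ^+ J.+1 * t.
  by rewrite exprS -mulrA ler_peMl ?ler1n// mulr_ge0 ?exprn_ge0// ltW.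
have := aS J; move: IH; case: ifPn => dJ IH aJ.
  rewrite ifT ?(lt_le_trans dJ)//; lra.
rewrite addr0; case: ifPn => dS; last lra.
have : a J.+1 <= b by exact: tb.
lra.
Qed.

Section carleson.
Context (R : realType) (n : nat).
Local Notation uhs := (upper_half_space R n).

(** With the radius of the ball as height of the box, the inclusions between
    boxes are those between the balls ([carleson_box_sub]). *)
Definition carleson_box (x : 'rV[R]_n) (r : R) : set uhs :=
  [set z | ball x r (uhs_space z) /\ uhs_height z < r].

Lemma measurable_carleson_box x r :
  measurable (carleson_box x r : set (borel uhs)).
Proof.
apply: open_borel; apply: openI.
  by have /continuousP := @continuous_uhs_space R n; apply; exact: ball_open.
have /continuousP := @continuous_uhs_height R n.
by move=> /(_ [set t | t < r]); apply; exact: open_lt.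
Qed.

Lemma carleson_box_sub (x y : 'rV[R]_n) (a b : R) :
  ball x (b - a) y -> 0 <= b - a -> carleson_box y a `<=` carleson_box x b.
Proof.
move=> xy ab z [yz hz]; split; last by rewrite (lt_le_trans hz)// -subr_ge0.
by have := ball_triangle xy yz; rewrite subrK.
Qed.

Lemma rat_center (x : 'rV[R]_n) (r : R) : 0 < r ->
  exists q : 'rV[rat]_n, ball x r (map_mx ratr q).
Proof.
move=> r0.
have /choice[q qP] : forall i : 'I_n, exists q : rat, `|x 0 i - ratr q| < r.
  move=> i; have [|q] := @rat_in_itvoo R (x 0 i - r) (x 0 i + r); first lra.
  rewrite in_itv/= => /andP[q1 q2]; exists q; rewrite ltr_norml; lra.
exists (\row_i q i); rewrite -ball_normE/= [ltLHS]/Num.norm /= mx_normrE.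
apply: bigmax_lt => // -[i j] _ /=; rewrite ord1 !mxE; exact: qP.
Qed.

End carleson.

(** * The weak type (1,1) bound *)

Section weak_type.
Context (R : realType) (n : nat) (p C : R).
Variable omega : {measure set (borel (upper_half_space R n)) -> \bar R}.
Variable sigma : {measure set (borel 'rV[R]_n) -> \bar R}.
Local Notation uhs := (upper_half_space R n).
Local Notation Rn := (borel 'rV[R]_n).
Local Notation v := (poisson sigma (cst 1%R)).
Local Open Scope ereal_scope.

Hypothesis const_gt0 : (0 < poisson_const R n)%R.
Hypothesis v_lty : forall z : uhs, v z < +oo.
Hypothesis C_gt0 : (0 < C)%R.
Hypothesis testing : forall z : uhs,
  poisson_uhs omega (fun w => v w `^ p) z <= C%:E * v z.

Let A : R := (n + 4)%:R `^ (n.+1%:R / 2).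

(** The power of 32 is the cost of replacing the radii [2^j t] by
    [2^j (32 t) = 16 (2^(j+1) t)]; [2 * A] is the constant of
    [poisson_uhs_lower]. *)
Definition weak_const : R := (32 ^+ n.+1 * (2 * A * C))%R.

Let A_gt0 : (0 < A)%R.
Proof. by rewrite powR_gt0// ltr0n addn_gt0 orbT. Qed.

Lemma weak_const_gt0 : (0 < weak_const)%R.
Proof. by rewrite mulr_gt0 ?exprn_gt0 ?mulr_gt0. Qed.

Lemma measurable_poisson1 : measurable_fun [set: borel uhs] v.
Proof. by apply: (measurable_poisson const_gt0) => // y; rewrite /= ler01. Qed.

Lemma measurable_poisson1_pow : measurable_fun [set: borel uhs] (fun w => v w `^ p).
Proof.
by apply: (measurableT_comp (measurable_poweR p)); exact: measurable_poisson1.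
Qed.

(** For a boundary point [y] at distance between [2^j t] and [2^(j+1) t] from
    the foot of [z], the term of index [j] alone dominates the kernel. *)
Lemma poisson_upper (f : Rn -> R) (z : uhs) : measurable_fun setT f -> (forall y, (0 <= f y)%R) ->
  poisson sigma f z <= \sum_(j <oo)
    (poisson_const R n * uhs_height z / (2 ^+ j * uhs_height z) ^+ n.+1)%:E *
    \int[sigma]_(y in (ball (uhs_space z) (2 ^+ j.+1 * uhs_height z) : set Rn)) (f y)%:E.
Proof.
move=> mf f0; set t := uhs_height z; have t0 : (0 < t)%R := uhs_height_gt0 z.
pose B j : set Rn := ball (uhs_space z) (2 ^+ j.+1 * t)%R.
have mB j : measurable (B j) by apply: open_borel; exact: ball_open.
pose a j : R := (poisson_const R n * t / (2 ^+ j * t) ^+ n.+1)%R.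
have a0 j : (0 <= a j)%R.
  rewrite (divr_ge0 (mulr_ge0 (ltW const_gt0) (ltW t0)))// exprn_ge0//.
  by rewrite mulr_ge0 ?exprn_ge0// ltW.
pose F j y := (a j)%:E * ((EFin \o f) \_ (B j)) y.
have F0 j y : 0 <= F j y.
  by rewrite mule_ge0 ?lee_fin// /patch; case: ifPn => //= _; rewrite lee_fin.
have mpatch j : measurable_fun setT ((EFin \o f) \_ (B j)).
  by apply/(measurable_restrictT _ _).1 => //; apply: measurable_funTS; exact/measurable_EFinP.
have mF j : measurable_fun setT (F j) by apply: measurable_funeM.
apply: (@le_trans _ _ (\int[sigma]_y \sum_(j <oo) F j y)).
  apply: ge0_le_integral => //.
  - by move=> y _; rewrite lee_fin mulr_ge0//; exact: pker_ge0.
  - exact: measurable_pker_mul.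
  - exact: ge0_emeasurable_sum.
  - move=> y _.
    have ex : exists j, (`|uhs_space z - (y : 'rV_n)| < 2 ^+ j.+1 * t)%R.
      exists (Num.bound (`|uhs_space z - (y : 'rV_n)| / t)%R).
      rewrite -ltr_pdivrMr// (lt_le_trans (archi_boundP _)) ?divr_ge0 ?(ltW t0)//.
      by rewrite -natrX ler_nat ltnW// ltnW// ltn_expl.
    case: (ex_minnP ex) => j yj jmin.
    apply: le_trans (nneseries_ge_term j _) => //.
    rewrite /F /patch mem_set; last by rewrite /B -ball_normE.
    rewrite -EFinM lee_fin ler_wpM2r//.
    apply: poisson_kernel_upper => //; first by rewrite mulr_gt0 ?exprn_gt0.
    (* On the first ball the kernel is controlled by the height [t]
       rather than by the distance to [y]. *)
    case: j yj jmin => [|j] yj jmin; first by rewrite expr0 mul1r lexx orbT.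
    by rewrite leNgt; case: ltP => // /jmin; rewrite ltnn.
rewrite integral_nneseries// lee_nneseries// => j _.
  by move=> _; exact: integral_ge0.
rewrite /F ge0_integralZl_EFin//; first by rewrite -integral_mkcond.
by move=> y _; rewrite /patch; case: ifPn => //= _; rewrite lee_fin.
Qed.

(** At a point [w], the boxes containing it are those of index at least some
    [j0]; their weights form a geometric series dominated by the first one,
    which is dominated by the kernel of [P^omega]. *)
Lemma poisson_uhs_lower (h : uhs -> \bar R) (z : uhs) :
  measurable_fun [set: borel uhs] h -> (forall w, 0 <= h w) ->
  \sum_(j <oo)
    (poisson_const R n * uhs_height z / (2 ^+ j * (32 * uhs_height z)) ^+ n.+1)%:E *
    \int[omega]_(w in (carleson_box (uhs_space z)
                         (2 ^+ j * (32 * uhs_height z)) : set (borel uhs))) h w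
  <= (2 * A)%:E * poisson_uhs omega h z.
Proof.
move=> mh h0; set t := uhs_height z; have t0 : (0 < t)%R := uhs_height_gt0 z.
set x := uhs_space z.
pose W j : set (borel uhs) := carleson_box x (2 ^+ j * (32 * t))%R.
have mW j : measurable (W j) by exact: measurable_carleson_box.
pose a j : R := (poisson_const R n * t / (2 ^+ j * (32 * t)) ^+ n.+1)%R.
have a0 j : (0 <= a j)%R.
  rewrite (divr_ge0 (mulr_ge0 (ltW const_gt0) (ltW t0)))// exprn_ge0//.
  by rewrite mulr_ge0 ?exprn_ge0// mulr_ge0// ltW.
pose F j w := (a j)%:E * (h \_ (W j)) w.
have F0 j y : 0 <= F j y by rewrite mule_ge0 ?lee_fin// /patch; case: ifPn.
have mpatch j : measurable_fun setT (h \_ (W j)).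
  by apply/(measurable_restrictT _ _).1 => //; exact: measurable_funTS.
have mF j : measurable_fun setT (F j) by apply: measurable_funeM.
pose k := uhs_ker z.
have k0 w : (0 <= k w)%R by exact: uhs_ker_ge0.
have mk : measurable_fun setT k by exact: measurable_uhs_ker.
have -> : \sum_(j <oo) (a j)%:E * \int[omega]_(w in W j) h w
    = \int[omega]_w \sum_(j <oo) F j w.
  rewrite integral_nneseries//; apply: eq_eseriesr => j _.
  have -> : \int[omega]_w F j w = (a j)%:E * \int[omega]_w (h \_ (W j)) w.
    rewrite /F ge0_integralZl_EFin//.
    by move=> y _; rewrite /patch; case: ifPn.
  by rewrite -integral_mkcond.
have mkh : measurable_fun setT (fun w => (k w)%:E * h w).
  by apply: emeasurable_funM => //; exact/measurable_EFinP.
rewrite -ge0_integralZl_EFin//; first last.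
- by rewrite mulr_ge0// ltW.
- by move=> w _; rewrite mule_ge0// lee_fin; exact: k0.
apply: ge0_le_integral => //.
- by move=> w _; exact: nneseries_ge0.
- exact: ge0_emeasurable_sum.
- exact: measurable_funeM.
move=> w _; rewrite muleA -EFinM.
apply: nneseries_le_partial => [//|J].
have -> : \sum_(0 <= j < J) F j w =
    (\sum_(0 <= j < J) (if w \in W j then a j else 0)%R)%:E * h w.
  rewrite -sumEFin ge0_sume_distrl.
    by apply: eq_bigr => j _; rewrite /F /patch; case: ifPn => _; rewrite ?mule0 ?mul0e.
  by move=> j _; case: ifPn => _; rewrite lee_fin.
rewrite lee_wpmul2r// lee_fin.
pose d : R := Num.max `|x - uhs_space w|%R (uhs_height w).
have WE j : (w \in W j) = (d < 2 ^+ j * (32 * t))%R.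
  rewrite gt_max; apply/idP/idP.
    by rewrite inE /W /carleson_box/= -ball_normE/= => -[-> ->].
  by move=> /andP[h1 h2]; rewrite inE /W /carleson_box/= -ball_normE.
have := @dyadic_tail_sum R n J d (32 * t)%R (A * k w / (poisson_const R n * t))%R.
have ct0 : (0 < poisson_const R n * t)%R by rewrite mulr_gt0.
move=> /(_ (mulr_gt0 _ t0) (divr_ge0 (mulr_ge0 (ltW A_gt0) (k0 w)) (ltW ct0))).
move=> /(_ (ltr0n _ 32)) /(_ _)/(ler_wpM2l (ltW ct0)).
rewrite mulr_sumr.
rewrite [X in (_ -> (_ <= X)%R) -> _](_ : _ = 2 * A * k w)%R; last first.
  by field; rewrite ?lt0r_neq0.
move=> H; apply: le_trans (H _).
  apply: ler_sum => j _; rewrite WE; case: ifPn => _; rewrite ?mulr0//.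
move=> j; rewrite -WE inE => -[xw hw].
rewrite ler_pdivlMr// mulrC.
have := @poisson_kernel_lower R n t (t + uhs_height w)%R (x - uhs_space w)
  (2 ^+ j * (32 * t))%R t0.
have h0w := uhs_height_gt0 w.
rewrite lerDl ltW// => /(_ isT).
move: xw; rewrite -ball_normE/= => /ltW -> /(_ isT).
have : (t <= 2 ^+ j * (32 * t))%R.
  have : (1 <= 2 ^+ j :> R)%R by rewrite exprn_ege1// ler1n.
  nra.
move=> tj /(_ _)/(ler_wpM2l (ltW A_gt0)) H2.
apply: le_trans (H2 _); last lra.
rewrite -/A le_eqVlt; apply/orP; left; apply/eqP.
by field; rewrite ?lt0r_neq0// exprn_gt0// mulr_gt0 ?exprn_gt0// mulr_gt0.
Qed.

(** If the conclusion failed at every dyadic multiple of the height of [z], then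
    comparing [poisson_upper] and [poisson_uhs_lower] term by term would give
    [P^sigma f (z) <= c v(z)]. *)
Lemma local_selection (f : Rn -> R) (h : uhs -> \bar R) (c : R) (z : uhs) :
  measurable_fun setT f -> (forall y, (0 <= f y)%R) ->
  measurable_fun [set: borel uhs] h -> (forall w, 0 <= h w) ->
  (forall w, h w <= v w `^ p) -> (0 < c)%R ->
  c%:E * v z < poisson sigma f z ->
  exists r : R, (uhs_height z < r)%R /\
    c%:E * \int[omega]_(w in (carleson_box (uhs_space z) (16 * r) : set (borel uhs))) h w
    <= weak_const%:E * \int[sigma]_(y in (ball (uhs_space z) r : set Rn)) (f y)%:E.
Proof.
move=> mf f0 mh h0 hv c0 cz; apply: contrapT => no.
set t := uhs_height z in no *; have t0 : (0 < t)%R := uhs_height_gt0 z.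
set x := uhs_space z in no *.
pose I j := \int[sigma]_(y in (ball x (2 ^+ j.+1 * t) : set Rn)) (f y)%:E.
pose J j := \int[omega]_(w in (carleson_box x (2 ^+ j * (32 * t)) : set (borel uhs))) h w.
pose a j : R := (poisson_const R n * t / (2 ^+ j * t) ^+ n.+1)%R.
pose b j : R := (poisson_const R n * t / (2 ^+ j * (32 * t)) ^+ n.+1)%R.
have I0 j : 0 <= I j by apply: integral_ge0 => y _; rewrite lee_fin.
have J0 j : 0 <= J j by exact: integral_ge0.
have ct0 : (0 < poisson_const R n * t)%R by rewrite mulr_gt0.
have a0 j : (0 <= a j)%R.
  by rewrite divr_ge0 ?(ltW ct0)// exprn_ge0// mulr_ge0 ?exprn_ge0// ltW.
have b0 j : (0 <= b j)%R.
  by rewrite divr_ge0 ?(ltW ct0)// exprn_ge0// !mulr_ge0 ?exprn_ge0// ltW.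
have ab j : a j = (32 ^+ n.+1 * b j)%R.
  rewrite /a /b [(2 ^+ j * (32 * t))%R]mulrCA [in RHS]exprMn; field.
  by rewrite !gt_eqF ?exprn_gt0// mulr_gt0 ?exprn_gt0.
have IJ j : weak_const%:E * I j <= c%:E * J j.
  rewrite leNgt; apply/negP => JI; apply: no; exists (2 ^+ j.+1 * t)%R; split.
    rewrite ltr_pMl// exprn_egt1//; first by rewrite ltr1n.
  rewrite (_ : 16 * (2 ^+ j.+1 * t) = 2 ^+ j * (32 * t))%R; first exact: ltW.
  by rewrite exprS; ring.
have up := poisson_upper z mf f0.
have lo := poisson_uhs_lower z mh h0.
have Kv : weak_const%:E * poisson sigma f z <= weak_const%:E * (c%:E * v z).
  apply: (@le_trans _ _ (weak_const%:E * \sum_(j <oo) (a j)%:E * I j)).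
    by rewrite lee_wpmul2l// lee_fin ltW// weak_const_gt0.
  rewrite -nneseriesZl; last by move=> j _; rewrite mule_ge0 ?lee_fin.
  apply: (@le_trans _ _ (\sum_(j <oo) (c * 32 ^+ n.+1)%:E * ((b j)%:E * J j))).
    apply: lee_nneseries => [j _ _|j _].
      by rewrite !mule_ge0 ?lee_fin ?(ltW weak_const_gt0).
    rewrite muleCA ab (_ : (c * _)%:E * _ = (32 ^+ n.+1 * b j)%:E * (c%:E * J j)).
      by rewrite -ab lee_wpmul2l ?lee_fin.
    by rewrite !muleA -!EFinM; congr (_%:E * _); ring.
  rewrite nneseriesZl; last by move=> j _; rewrite mule_ge0 ?lee_fin.
  apply: (@le_trans _ _ ((c * 32 ^+ n.+1)%:E * ((2 * A)%:E * (C%:E * v z)))).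
    rewrite lee_wpmul2l//; first by rewrite lee_fin mulr_ge0 ?exprn_ge0 ?ltW.
    apply: le_trans lo _; rewrite lee_wpmul2l//.
      by rewrite lee_fin mulr_ge0// ltW.
    apply: le_trans (testing z).
    have k0 w : (0 <= uhs_ker z w)%R by exact: uhs_ker_ge0.
    have mk : measurable_fun [set: borel uhs] (EFin \o uhs_ker z).
      by apply/measurable_EFinP; exact: measurable_uhs_ker.
    apply: ge0_le_integral => //.
    - by move=> w _; rewrite mule_ge0// lee_fin; exact: k0.
    - exact: (emeasurable_funM mk).
    - exact: (emeasurable_funM mk measurable_poisson1_pow).
    - by move=> w _; rewrite lee_wpmul2l// lee_fin; exact: k0.
  rewrite le_eqVlt; apply/orP; left; apply/eqP.
  rewrite !muleA -!EFinM; congr (_%:E * _); rewrite /weak_const; ring.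
move: Kv; rewrite lee_pmul2l ?fin_numE//; last first.
  by rewrite lte_fin weak_const_gt0.
by rewrite leNgt cz.
Qed.

(** The constant is independent of [f] and [c]. For each finite subfamily of the
    rational boxes the bound holds by a Vitali selection, and the union of the
    whole family covers the level set. *)
Lemma poisson_weak_type (f : Rn -> R) (c : R) :
  measurable_fun setT f -> (forall y, (0 <= f y)%R) -> (0 < c)%R ->
  c%:E * \int[omega]_(w in [set w : borel uhs | c%:E * v w < poisson sigma f w]) v w `^ p
    <= weak_const%:E * \int[sigma]_y (f y)%:E.
Proof.
move=> mf f0 c0; set E := [set w | _].
have mE : measurable E.
  rewrite -[E]setTI; apply: measurable_lte => //.
    by apply: measurable_funeM; exact: measurable_poisson1.
  exact: measurable_poisson.
pose h : borel uhs -> \bar R := (fun w => v w `^ p) \_ E.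
have h0 w : 0 <= h w by rewrite /h /patch; case: ifPn => // _; rewrite poweR_ge0.
have hv w : h w <= v w `^ p by rewrite /h /patch; case: ifPn => // _; rewrite poweR_ge0.
have mh : measurable_fun setT h.
  apply/(measurable_restrictT _ _).1 => //.
  by apply: measurable_funTS; exact: measurable_poisson1_pow.
rewrite integral_mkcond -/h.
pose I := ('rV[rat]_n * rat)%type.
pose ctr (i : I) : 'rV[R]_n := map_mx ratr i.1.
pose rad (i : I) : R := ratr i.2.
pose B i : set Rn := ball (ctr i) (rad i).
pose W i : set (borel uhs) := carleson_box (ctr i) (rad i).
pose W3 i : set (borel uhs) := carleson_box (ctr i) (3 * rad i).
have mB i : measurable (B i) by apply: open_borel; exact: ball_open.
have mW i : measurable (W i) by exact: measurable_carleson_box.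
have mW3 i : measurable (W3 i) by exact: measurable_carleson_box.
pose good i := `[< c%:E * \int[omega]_(w in W3 i) h w
   <= weak_const%:E * \int[sigma]_(y in B i) (f y)%:E >].
pose s N : seq I := [seq i <- pmap unpickle (iota 0 N) | good i].
pose G N := \big[setU/set0]_(i <- s N) W i.
have mfE D : measurable_fun D (EFin \o f).
  by apply: measurable_funTS; exact/measurable_EFinP.
have mG N : measurable (G N) by exact: bigsetU_measurable.
have bound N : c%:E * \int[omega]_(w in G N) h w
    <= weak_const%:E * \int[sigma]_y (f y)%:E.
  pose meet i j := `[< B i `&` B j !=set0 >].
  have meetC : symmetric meet by move=> i j; rewrite /meet setIC.
  have [D [uD Ds disj sel]] := vitali_selection rad (s N) meetC.
  have GD : G N `<=` \big[setU/set0]_(j <- D) W3 j.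
    rewrite /G -!bigcup_seq => z [i /sel[j jD ij] Wiz]; exists j => //.
    have ri : (0 < rad i)%R by apply: lt_trans Wiz.2; exact: uhs_height_gt0.
    suff [rj ctrij] : (0 <= 3 * rad j - rad i)%R /\ ball (ctr j) (3 * rad j - rad i)%R (ctr i).
      exact: carleson_box_sub Wiz.
    case/orP: ij => [/eqP <-|/andP[/asboolP[y [Biy Bjy]] rij]].
      by split; [lra|apply: ballxx; lra].
    split; first lra.
    apply: (@le_ball _ _ _ (rad j + rad i)%R); first lra.
    exact: ball_triangle Bjy (ball_sym Biy).
  apply: (@le_trans _ _ (c%:E * \sum_(j <- D) \int[omega]_(w in W3 j) h w)).
    rewrite lee_wpmul2l ?lee_fin ?(ltW c0)//.
    apply: le_trans (integral_bigsetU_le _ h0 mh D mW3).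
    apply: ge0_subset_integral => //; last exact: measurable_funTS.
    exact: bigsetU_measurable.
  rewrite ge0_sume_distrr; last by move=> j _; exact: integral_ge0.
  apply: (@le_trans _ _ (\sum_(j <- D) weak_const%:E * \int[sigma]_(y in B j) (f y)%:E)).
    rewrite big_seq [leRHS]big_seq; apply: lee_sum => j /Ds.
    by rewrite mem_filter => /andP[/asboolP].
  rewrite -ge0_sume_distrr; last first.
    by move=> j _; apply: integral_ge0 => y _; rewrite lee_fin.
  rewrite lee_wpmul2l ?lee_fin ?(ltW weak_const_gt0)//.
  rewrite -ge0_integral_bigsetU//.
  - apply: ge0_subset_integral => //; first exact: bigsetU_measurable.
    by move=> y _; rewrite lee_fin.
  - move=> i j iD jD [y [Biy Bjy]]; apply/eqP; apply: contraT => ij.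
    by have /asboolP := disj _ _ iD jD ij; case; exists y.
  - by move=> y _; rewrite lee_fin.
have ndG : nondecreasing_seq G.
  move=> M N MN; apply/subsetPset; rewrite /G -!bigcup_seq => z [i iM Wiz].
  exists i => //; move: iM; rewrite /= /s !mem_filter => /andP[-> /=].
  rewrite -(subnKC MN) iotaD; rewrite !mem_pmap map_cat mem_cat => ->//.
(* Let [x] be the foot of [z], and [r] the radius from [local_selection]. With
   [q] rational within [r] of [x], and [u] rational in [(2 r, 4 r)], the ball
   [B(q, u)] contains [B(x, r)], and the tripled box [W(q, 3 u)] is contained
   in [W(x, 3 u + r)], hence in [W(x, 16 r)]. *)
have cover : E `<=` \bigcup_N G N.
  move=> z Ez.
  have [r [hr Hr]] := local_selection mf f0 mh h0 hv c0 Ez.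
  have r0 : (0 < r)%R by apply: lt_trans hr; exact: uhs_height_gt0.
  have [q qP] := rat_center (uhs_space z) r0.
  have [|u] := @rat_in_itvoo R (2 * r) (4 * r); first lra.
  rewrite in_itv/= => /andP[u1 u2].
  pose i : I := (q, u).
  have cz : ball (uhs_space z) r (ctr i) by [].
  exists (pickle i).+1 => //; rewrite /G -bigcup_seq; exists i; last first.
    split; last by rewrite /rad/=; lra.
    by apply: ball_sym; apply: le_ball cz; rewrite /rad/=; lra.
  rewrite /= mem_filter; apply/andP; split; last first.
    rewrite mem_pmap; apply/mapP; exists (pickle i); last by rewrite pickleK.
    by rewrite mem_iota add0n ltnS leqnn.
  apply/asboolP; apply: (@le_trans _ _ (c%:E * \int[omega]_(w in
      (carleson_box (uhs_space z) (16 * r) : set (borel uhs))) h w)).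
    rewrite lee_wpmul2l ?lee_fin ?(ltW c0)//.
    apply: ge0_subset_integral => //.
    - exact: measurable_carleson_box.
    - exact: measurable_funTS.
    - apply: carleson_box_sub; last by rewrite /rad/=; lra.
      by apply: le_ball cz; rewrite /rad/=; lra.
  apply: (le_trans Hr); apply: lee_wpmul2l; first by rewrite lee_fin ltW// weak_const_gt0.
  apply: ge0_subset_integral => //.
  - by apply: open_borel; exact: ball_open.
  - by move=> y _; rewrite lee_fin.
  - move=> y zy; rewrite /B; apply: (@le_ball _ _ _ (r + r)%R); first by rewrite /rad/=; lra.
    exact: ball_triangle (ball_sym cz) zy.
have -> : \int[omega]_w h w = \int[omega]_(w in \bigcup_N G N) h w.
  rewrite [RHS]integral_mkcond; apply: eq_integral => w _.
  rewrite /patch; case: ifPn => // /negP wG; rewrite /h /patch.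
  by case: ifPn => // wE; exfalso; apply: wG; rewrite inE; apply: cover; exact/set_mem.
rewrite -lee_pdivlMl//.
have := @ge0_nondecreasing_set_cvg_integral _ _ _ G h omega ndG mG.
move=> /(_ _ _)/cvg_lim <-//.
- apply: lime_le.
  + apply: ereal_nondecreasing_is_cvgn.
    by apply: ge0_nondecreasing_set_nondecreasing_integral => // N; exact: measurable_funTS.
  + by apply: nearW => N; rewrite lee_pdivlMl//; exact: bound.
- by move=> N; exact: measurable_funTS.
Qed.

End weak_type.

(** * The theorem *)

Theorem theorem6p3 (R : realType) (n : nat) (p : R)
    (omega : {measure set (borel (upper_half_space R n)) -> \bar R})
    (sigma : {measure set (borel 'rV[R]_n) -> \bar R}) :
  (0 < n)%N ->
  1 < p ->
  locally_finite omega ->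
  locally_finite sigma ->
  (exists z : upper_half_space R n,
     poisson sigma (cst 1%R) z <> +oo%E) ->
  (exists C : R, forall z : upper_half_space R n,
    (poisson_uhs omega (fun w => poisson sigma (cst 1%R) w `^ p) z
       <= C%:E * poisson sigma (cst 1%R) z)%E) ->
  exists C' : R, forall f : borel 'rV[R]_n -> R,
    f \in Lfun sigma p%:E ->
    ('N[omega]_(p%:E) [poisson sigma f]
       <= C'%:E * 'N[sigma]_(p%:E) [EFin \o f])%E.
Proof.
move=> _ p1 _ _ [z0 vz0] [C testing].
have p0 : 0 < p by rewrite (lt_trans _ p1).
(* If the normalizing constant vanished, so would the kernel; splitting cases
   replaces a proof that the Gamma integral is positive and finite. *)
have := poisson_const_ge0 R n; rewrite le_eqVlt => /predU1P[c0|c0].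
  exists 0 => f _; rewrite mul0e.
  have -> : poisson sigma f = cst 0%E.
    apply/funext => z; rewrite /poisson; under eq_integral => y _.
      by rewrite /poisson_kernel -c0 !mul0r; over.
    exact: integral0.
  by rewrite Lnorm0// eqe gt_eqF.
have v_lty z : (poisson sigma (cst 1%R) z < +oo)%E.
  by apply: (@poisson_lty R n sigma (cst 1) z z0) => //; rewrite ltey; apply/eqP.
(* The comparison of sums behind the weak type bound cancels [weak_const],
   which therefore has to be positive. *)
pose C1 := Num.max C 1.
have C1_gt0 : 0 < C1 by rewrite lt_max ltr01 orbT.
have v_ge0 z : (0 <= poisson sigma (cst 1%R) z)%E by exact: poisson_nonneg.
have testing1 z : (poisson_uhs omega (fun w => poisson sigma (cst 1%R) w `^ p) z
       <= C1%:E * poisson sigma (cst 1%R) z)%E.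
  apply: le_trans (testing z) _; rewrite lee_wpmul2r// lee_fin.
  by rewrite le_max lexx.
pose K := interpolation_const p (weak_const n C1).
have K0 : 0 <= K by apply: interpolation_const_ge0 => //; exact/ltW/weak_const_gt0.
exists (K `^ p^-1) => f; rewrite inE => /andP[].
rewrite !inE /= /finite_norm => mf Lf.
pose absf (y : borel 'rV[R]_n) : R := `|f y|.
have absf_p : (\int[sigma]_y (absf y `^ p)%:E < +oo)%E.
  move: Lf; rewrite unlock => /(lty_poweRy (invr_neq0 (lt0r_neq0 p0))).
  by [].
have absf0 y : 0 <= absf y by exact: normr_ge0.
have mf' : measurable_fun setT absf.
  exact: measurableT_comp.
have Tfin z : (poisson sigma absf z < +oo)%E.
  by apply: poisson_Lp_lty absf_p => //; exact: ltW.
have strong : (\int[omega]_z poisson sigma absf z `^ p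
    <= K%:E * \int[sigma]_y (absf y `^ p)%:E)%E.
  apply: (@interpolation _ _ _ _ _ sigma omega (@poisson R n sigma)
    (poisson sigma (cst 1%R)) p (weak_const n C1)) => //.
  - exact/ltW/weak_const_gt0.
  - exact: measurable_poisson1.
  - by move=> g z [mg g0]; exact: poisson_nonneg.
  - by move=> g [mg g0]; exact: measurable_poisson.
  - by move=> g z [mg g0]; exact: poisson_null.
  - by move=> g h c z [mg g0] [mh h0]; exact: poisson_sub.
  - by move=> g c [mg g0] c1; exact: (poisson_weak_type c0 v_lty C1_gt0 testing1).
have mPf : measurable_fun [set: borel (upper_half_space R n)] (poisson sigma f).
  exact: measurable_poisson_signed.
have mPa : measurable_fun [set: borel (upper_half_space R n)] (poisson sigma absf).
  exact: measurable_poisson_signed.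
have mpow (g : upper_half_space R n -> \bar R) :
    measurable_fun [set: borel (upper_half_space R n)] g ->
    measurable_fun [set: borel (upper_half_space R n)] (fun z => g z `^ p)%E.
  by move=> mg; apply: (measurableT_comp (measurable_poweR p)).
rewrite unlock.
apply: (@le_trans _ _ ((K%:E * \int[sigma]_y (absf y `^ p)%:E) `^ p^-1)%E).
  apply: gt0_ler_poweR.
  - by rewrite invr_ge0 ltW.
  - by rewrite in_itv/= leey andbT; apply: integral_ge0 => z _; exact: poweR_ge0.
  - rewrite in_itv/= leey andbT mule_ge0 ?lee_fin//.
    by apply: integral_ge0 => y _; rewrite lee_fin powR_ge0.
  apply: le_trans strong; apply: ge0_le_integral => //.
  - by move=> z _; exact: poweR_ge0.
  - by apply: mpow; exact: (measurableT_comp _ mPf).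
  - by exact: mpow.
  - move=> z _; apply: gt0_ler_poweR; rewrite ?(ltW p0)// ?in_itv/= ?leey ?andbT//.
      exact: poisson_nonneg.
    apply: le_trans (le_abse_integral _ _ _) _ => //.
      exact: measurable_pker_mul.
    apply: ge0_le_integral => //.
    + by apply: measurableT_comp => //; exact: measurable_pker_mul.
    + exact: measurable_pker_mul.
    + move=> y _; rewrite abse_EFin lee_fin normrM ger0_norm//.
      exact: pker_ge0.
rewrite poweRM//; last by apply: integral_ge0 => y _; rewrite lee_fin powR_ge0.
Qed.
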